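(* Let $G$ be a 2-connected graph. If $G$ is claw-o-heavy and $N$-p-heavy, then $G$ is hamiltonian.
   Context: All graphs are finite and simple; $n=|V(G)|$. A pair of nonadjacent vertices $\{u,v\}$ of $G$ is a heavy pair if $d(u)+d(v)\geq n$. $G$ is claw-o-heavy if every induced claw ($K_{1,3}$) of $G$ contains a heavy pair of $G$. The net $N$ is the graph consisting of a triangle $abc$ together with three pendant edges $aa_1$, $bb_1$, $cc_1$. An induced subgraph $M$ of $G$ isomorphic to $N$ (labelled this way) is p-heavy in $G$ if there are two vertices $u,v$ of $M$ with $d_G(u)+d_G(v)\geq n$ such that $\{u,v\}\notin\{\{a,a_1\},\{b,b_1\},\{c,c_1\}\}$; $G$ is $N$-p-heavy if every induced $N$ in $G$ is p-heavy. *)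

(* Defs.v *)
From mathcomp Require Import all_boot.

Set Implicit Arguments.
Unset Strict Implicit.
Unset Printing Implicit Defensive.

Record sgraph := SGraph {
  vertex :> finType;
  adj : rel vertex;
  adj_sym : symmetric adj;
  adj_irr : irreflexive adj
}.

Section Graph.
Variable G : sgraph.
Implicit Types u v : G.

Definition degree u : nat := #|[set v | adj u v]|.

Definition heavy_pair u v : Prop :=
  [/\ u != v, ~~ adj u v & #|G| <= degree u + degree v].

Definition connected : Prop :=
  0 < #|G| /\ forall u v, connect (@adj G) u v.

(* [ucycle] alone admits cycles on one edge (size 2), hence the size bound. *)
Definition hamiltonian : Prop :=
  exists c : seq G, [/\ ucycle (@adj G) c, 2 < size c & forall v, v \in c].

End Graph.

Section Induced.
Variables (G : sgraph) (A : {set G}).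

Definition induced_adj : rel {x : G | x \in A} :=
  fun x y => adj (val x) (val y).

Lemma induced_adj_sym : symmetric induced_adj.
Proof. by move=> x y; exact: adj_sym. Qed.

Lemma induced_adj_irr : irreflexive induced_adj.
Proof. by move=> x; exact: adj_irr. Qed.

Definition induced : sgraph := SGraph induced_adj_sym induced_adj_irr.

End Induced.

Definition k_connected (k : nat) (G : sgraph) : Prop :=
  k < #|G| /\ forall S : {set G}, #|S| < k -> connected (induced (~: S)).

(* A labelled induced copy of H in G. *)
Definition induced_copy (H G : sgraph) (f : H -> G) : Prop :=
  injective f /\ forall x y : H, adj (f x) (f y) = adj x y.

Section CompleteBipartite.
Variables m n : nat.

Definition biclique_adj : rel ('I_m + 'I_n) := fun x y =>
  match x, y with
  | inl _, inr _ | inr _, inl _ => true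
  | _, _ => false
  end.

Lemma biclique_adj_sym : symmetric biclique_adj.
Proof. by case=> ? []. Qed.

Lemma biclique_adj_irr : irreflexive biclique_adj.
Proof. by case. Qed.

Definition biclique : sgraph := SGraph biclique_adj_sym biclique_adj_irr.

End CompleteBipartite.

Definition claw : sgraph := biclique 1 3.

(* (i, false), i < 3, are the triangle vertices a, b, c; (i, true) is the
   pendant vertex a_1, b_1, c_1 attached to (i, false). *)
Definition net_adj : rel ('I_3 * bool) := fun x y =>
  match x, y with
  | (i, false), (j, false) => i != j
  | (i, false), (j, true) | (i, true), (j, false) => i == j
  | (_, true), (_, true) => false
  end.

Lemma net_adj_sym : symmetric net_adj.
Proof. by move=> [i []] [j []] //=; rewrite eq_sym. Qed.

Lemma net_adj_irr : irreflexive net_adj.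
Proof. by move=> [i []] //=; rewrite eqxx. Qed.

Definition net : sgraph := SGraph net_adj_sym net_adj_irr.

Definition claw_o_heavy (G : sgraph) : Prop :=
  forall f : claw -> G, induced_copy f ->
    exists x y : claw, heavy_pair (f x) (f y).

Definition net_p_heavy_copy (G : sgraph) (f : net -> G) : Prop :=
  exists x y : net,
    [/\ f x != f y,
        #|G| <= degree (f x) + degree (f y) &
        forall i : 'I_3, [set f x; f y] != [set f (i, false); f (i, true)]].

Definition net_p_heavy (G : sgraph) : Prop :=
  forall f : net -> G, induced_copy f -> net_p_heavy_copy f.

(* Main.v *)
Require Import Defs.
From mathcomp Require Import all_boot.
From mathcomp Require Import zify.

Set Implicit Arguments.
Unset Strict Implicit.
Unset Printing Implicit Defensive.

(** Call distinct vertices o-adjacent if they are adjacent or their degree sum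
    is at least n.  By Bondy-Chvatal rotations the vertices of a cycle of the
    o-adjacency relation lie on a cycle of G, so a longest cycle C of G is also
    a longest o-cycle.  If C is not hamiltonian, take a path outside C joining
    x and y on C.  The claws at x and y make x, y and their neighbours on C two
    disjoint o-triangles, joined by three arcs (two from C and the path).  Grow
    the two triangles into disjoint "triads" S, S' as long as possible: a triad
    has three terminals, one per arc, and enough spanning o-paths for any
    o-edge between S and S', other than one joining the terminals of a common
    arc, to close up to an o-cycle through all the vertices.

    When no growth is possible, the first vertices of the arcs hang on S as
    pendant vertices.  If S had no two vertices with degree sum at least n,
    o-adjacency and adjacency would agree on S and these three vertices, which
    would then span a claw-free graph; it contains an induced net, and its
    p-heavy pair can only lie in the triangle, inside S.  Hence both S and S'
    contain pairs u1, u2 and v1, v2 of degree sum at least n.  One of u1v1,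
    u2v2 and one of u1v2, u2v1 then has degree sum at least n, which
    contradicts that the o-edges between S and S' form a matching. *)

(** * Ore-adjacency and Bondy-Chvatal rotations *)

(** Pigeonhole on the [size p] consecutive pairs of the walk: [b] is counted on first members and
    [a] on second members, so some pair is counted twice. *)
Lemma count_crossing (T : Type) (a b : pred T) x p :
  size p < count a p + count b (belast x p) ->
  exists p1 y p2, [/\ p = p1 ++ y :: p2, b (last x p1) & a y].
Proof.
elim: p x => [|y p IH] x //= H.
case ay: (a y); case bx: (b x); first by exists [::], y, p.
all: have {}H : size p < count a p + count b (belast y p)
  by move: H; rewrite ay bx /=; lia.
all: have [p1 [y' [p2 [-> bl ay']]]] := IH _ H; by exists (y :: p1), y', p2.
Qed.

(** The last clause lets the initial segment inherit from [p] the avoidance of a given vertex. *)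
Lemma first_hit (T : eqType) (e : rel T) (a : pred T) x p :
  ~~ a x -> a (last x p) -> path e x p ->
  exists q y, [/\ path e x (rcons q y), a y, all (predC a) (x :: q) &
                  {subset rcons q y <= p}].
Proof.
elim: p x => [|y p IH] x /= nax; first by rewrite (negbTE nax).
case ay: (a y) => al /andP[exy py].
  exists [::], y; split; rewrite /= ?exy ?nax //.
  by move=> z; rewrite inE => /eqP->; rewrite mem_head.
have [q [y' [q1 ay' q2 qs]]] := IH _ (negbT ay) al py.
exists (y :: q), y'; split; rewrite /= ?exy ?nax //.
move=> z; rewrite inE => /orP[/eqP->|/qs]; first exact: mem_head.
by rewrite inE => ->; rewrite orbT.
Qed.

Section OreAdjacency.
Variable G : sgraph.
Implicit Types (u v x y : G) (c p q s : seq G).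

Definition oadj u v :=
  (u != v) && (adj u v || (#|G| <= degree u + degree v)).

Lemma adj_neq u v : adj u v -> u != v.
Proof. by apply: contraTneq => ->; rewrite adj_irr. Qed.

Lemma oadj_sym : symmetric oadj.
Proof. by move=> u v; rewrite /oadj eq_sym adj_sym addnC. Qed.

Lemma adj_oadj : subrel (@adj G) oadj.
Proof. by move=> u v uv; rewrite /oadj (adj_neq uv) uv. Qed.

(** Termination measure of [ocycle_cover]: an o-cycle of measure 0 is a cycle of [G]. *)
Fixpoint nonedges x p : nat :=
  if p is y :: p' then ~~ adj x y + nonedges y p' else 0.

Lemma nonedges_cat x p q :
  nonedges x (p ++ q) = nonedges x p + nonedges (last x p) q.
Proof. by elim: p x => [|y p IH] x //=; rewrite IH addnA. Qed.

Lemma nonedges_rev x p :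
  nonedges (last x p) (rev (belast x p)) = nonedges x p.
Proof.
elim: p x => [|y p IH] x //=.
rewrite rev_cons -cats1 nonedges_cat IH /= addn0 addnC adj_sym.
by case: p {IH} => //= z p; rewrite rev_cons last_rcons.
Qed.

Lemma nonedges0_path x p : nonedges x p = 0 -> path (@adj G) x p.
Proof.
elim: p x => [|y p IH] x //= /eqP; rewrite addn_eq0 eqb0 negbK.
by case/andP=> -> /eqP/IH.
Qed.

Lemma nonedges_gt0 x p : 0 < nonedges x p ->
  exists p1 y p2, p = p1 ++ y :: p2 /\ ~~ adj (last x p1) y.
Proof.
elim: p x => [|y p IH] x //=.
case xy: (adj x y) => /=; last by exists [::], y, p; rewrite /= xy.
by case/IH=> p1 [z [p2 [-> H]]]; exists (y :: p1), z, p2.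
Qed.

Lemma degree_count u c : uniq c ->
  degree u = count (adj u) c + #|[set v | adj u v] :\: [set v in c]|.
Proof.
move=> Uc; rewrite /degree -(cardsID [set v in c]); congr (_ + _).
rewrite -size_filter -(card_uniqP (filter_uniq _ Uc)).
by apply: eq_card => v; rewrite !inE mem_filter.
Qed.

Lemma heavy_path_rotation v p : uniq (v :: p) -> path oadj v p ->
  #|G| <= degree v + degree (last v p) -> 1 < size p ->
  ~~ adj v (last v p) ->
  exists y q, [/\ ucycle oadj (y :: q), {subset v :: p <= y :: q} &
     nonedges y (rcons q y) <= nonedges v p].
Proof.
set u := last v p => Up op hvy sp nvu.
case E: [exists w, [&& w \notin v :: p, adj v w & adj u w]].
  have [w /and3P[wp vw uw]] := existsP E.
  exists w, (v :: p); split.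
  - rewrite /ucycle /= rcons_path op -/u ![oadj _ w]adj_oadj // !(oadj_sym w) //.
    rewrite !adj_oadj //=; move: wp Up; rewrite /= => -> //.
  - by move=> z zp; rewrite inE zp orbT.
  - rewrite rcons_cons /= -cats1 nonedges_cat -/u /= uw (adj_sym w) vw /=; lia.
have NE w : w \notin v :: p -> adj v w -> adj u w -> False.
  by move=> H1 H2 H3; move/existsP: E; apply; exists w; apply/and3P.
(* Since the neighbourhoods of the ends off the path are disjoint, at most n - ([size p] + 1) of the
   degree sum falls there, and the counts on the path exceed [size p]. *)
have [|p1 [y [p2 [Ep ul vy]]]] := @count_crossing _ (adj v) (adj u) v p.
  move: hvy; rewrite !(degree_count _ Up).
  have -> : count (adj v) (v :: p) = count (adj v) p by rewrite /= adj_irr.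
  have -> : count (adj u) (v :: p) = count (adj u) (belast v p).
    by rewrite lastI -cats1 count_cat /= -/u adj_irr addn0 addn0.
  set X := [set x in _]; set Nv := [set _ | _]; set Nu := [set _ | _].
  have D : [disjoint Nv :\: X & Nu :\: X].
    apply/pred0P=> w /=; rewrite !inE; apply/negP.
    by case/andP=> /andP[H1 H2] /andP[_ H3]; apply: (@NE w); rewrite ?inE.
  have : #|Nv :\: X| + #|Nu :\: X| <= #|~: X|.
    rewrite -cardsUI (_ : _ :&: _ = set0) ?cards0 ?addn0; last first.
      by apply/eqP; rewrite setI_eq0.
    by apply: subset_leq_card; apply/subsetP=> w; rewrite !inE => /orP[] /andP[].
  have : #|X| = (size p).+1 by rewrite cardsE (card_uniqP Up).
  have := cardsC X; lia.
have lu : u = last y p2 by rewrite /u Ep last_cat.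
(* Follow the path from [y] to [u], take the chord to the predecessor of [y], go back to [v] and
   return by the chord to [y]. *)
exists y, (p2 ++ rev (v :: p1)).
have Pm : perm_eq (y :: p2 ++ rev (v :: p1)) (v :: p).
  by rewrite Ep -cat_cons perm_catC perm_sym -cat_cons perm_cat2r perm_sym perm_rev.
split.
- rewrite /ucycle (perm_uniq Pm) Up andbT /=.
  move: op; rewrite Ep cat_path /= => /and3P[op1 o1 op2].
  rewrite rcons_path cat_path op2 -lu /= last_cat -lu.
  rewrite rev_cons last_rcons adj_oadj //= andbT.
  have : path oadj (last v p1) (rev (belast v p1)).
    by rewrite rev_path; apply: sub_path op1 => a b; rewrite oadj_sym.
  have -> : rcons (rev p1) v = last v p1 :: rev (belast v p1).
    by rewrite -rev_cons lastI rev_rcons.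
  by rewrite /= adj_oadj.
- by move=> z; rewrite (perm_mem Pm).
- have -> : rcons (p2 ++ rev (v :: p1)) y =
     p2 ++ (last v p1 :: rev (belast v p1)) ++ [:: y].
    by rewrite -cats1 -catA lastI rev_rcons.
  rewrite nonedges_cat -lu /= ul nonedges_cat nonedges_rev /=.
  have -> : last (last v p1) (rev (belast v p1)) = v.
    by case: (p1) => //= a b; rewrite rev_cons last_rcons.
  by rewrite vy Ep nonedges_cat /=; lia.
Qed.

(** Cut the o-cycle at a nonedge: its ends are o-adjacent, hence of degree sum at least n, and
    rotation closes the path again with fewer nonedges. Vertices may be gained but never lost. *)
Lemma ocycle_cover x s : ucycle oadj (x :: s) -> 1 < size s ->
  exists c, ucycle (@adj G) c /\ {subset x :: s <= c}.
Proof.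
have [n] := ubnP (nonedges x (rcons s x)); elim: n => // n IH in x s *.
move=> lt_n oc ss.
have [E|gt0] := posnP (nonedges x (rcons s x)).
  exists (x :: s); split=> //; rewrite /ucycle; case/andP: oc => _ ->.
  by rewrite /= nonedges0_path.
have [p1 [y [p2 [Ep nadj]]]] := nonedges_gt0 gt0.
have [v [p [Pm pp lo nl nn]]] : exists v p, [/\ perm_eq (v :: p) (x :: s),
    path oadj v p, oadj (last v p) v, ~~ adj v (last v p) &
    nonedges v p < nonedges x (rcons s x)].
  move: oc => /andP[/= oc _].
  (* If [p2] is empty, the nonedge is the closing pair of the cycle; otherwise the cycle is rotated
     to start at [y]. *)
  case: (lastP p2) Ep => [|r z] Ep.
    rewrite cats1 in Ep; have [Es Ey] := rcons_inj Ep; rewrite -{}Es -{}Ey in nadj *.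
    exists x, s; split=> //; try by move: oc; rewrite rcons_path => /andP[].
      by rewrite adj_sym.
    by rewrite -cats1 nonedges_cat /= nadj; lia.
  rewrite -rcons_cons -rcons_cat in Ep; have [Es Ez] := rcons_inj Ep.
  exists y, (r ++ x :: p1); split.
  - by rewrite Es -cat_cons perm_catC.
  - move: oc; rewrite Es rcons_path cat_path /= last_cat /= cat_path /=.
    by case/andP=> /and3P[-> _ ->] ->.
  - move: oc; rewrite Es last_cat /= rcons_path cat_path /=.
    by case/andP=> /and3P[_ -> _].
  - by rewrite last_cat /= adj_sym.
  - by rewrite Es -cats1 -catA cat_cons !nonedges_cat /= !nonedges_cat nadj /=; lia.
case/andP: oc => oc Uxs.
have Up : uniq (v :: p) by rewrite (perm_uniq Pm).
have sp : size p = size s by have := perm_size Pm => -[].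
have hv : #|G| <= degree v + degree (last v p).
  by move: lo; rewrite /oadj adj_sym (negbTE nl) addnC => /andP[].
have [|y' [q [oq qs nq]]] := heavy_path_rotation Up pp hv _ nl; first by rewrite sp.
have [||c [uc sc]] := IH y' q _ oq.
- lia.
- have : size (v :: p) <= size (y' :: q) by apply: uniq_leq_size.
  by rewrite /= sp; lia.
by exists c; split=> // w; rewrite -(perm_mem Pm) => /qs /sc.
Qed.

End OreAdjacency.

(** * Triads *)

(** Sequences are permutations of each other when every predicate has equal counts on them, which
    leaves linear arithmetic. *)
Ltac perm_count :=
  repeat match goal with
  | H : is_true (perm_eq _ _) |- _ => move/permP in H
  end;
  apply/permP;
  let pr := fresh "pr" in intro pr;
  repeat match goal with
  | H : eqfun _ _ |- _ => generalize (H pr); clear H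
  end;
  repeat (rewrite ?count_cat ?count_rev /=); clear; lia.

Lemma ord3_third (i j : 'I_3) : i != j -> exists k : 'I_3, (k != i) && (k != j).
Proof.
(* The three indices add up to 0 + 1 + 2 = 3. *)
move=> ij; exists (inord (3 - i - j)).
move: (ltn_ord i) (ltn_ord j) ij; rewrite -!val_eqE /= => *.
by rewrite inordK; lia.
Qed.

Lemma ord3_third_uniq (i j k l : 'I_3) :
  i != j -> k != i -> k != j -> l != i -> l != j -> l = k.
Proof.
move: (ltn_ord i) (ltn_ord j) (ltn_ord k) (ltn_ord l).
by rewrite -!val_eqE /= => *; apply: val_inj => /=; lia.
Qed.

Lemma ord3_other (i : 'I_3) : exists j : 'I_3, j != i.
Proof.
(* The boolean read as a number: 1 when [i] is 0, and 0 otherwise. *)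
exists (inord (i == ord0)).
by rewrite -!val_eqE /= inordK; case: i => -[].
Qed.

Lemma perm_ord3 (T : eqType) (A : 'I_3 -> seq T) (i j k : 'I_3) :
  i != j -> k != i -> k != j ->
  perm_eq (flatten [seq A l | l <- enum 'I_3]) (A i ++ A j ++ A k).
Proof.
move=> ij ki kj.
have P : perm_eq (enum 'I_3) [:: i; j; k].
  apply: uniq_perm; first exact: enum_uniq.
    by rewrite /= !inE !negb_or ij eq_sym ki eq_sym kj.
  move=> l; rewrite mem_enum !inE; apply/esym.
  by case: eqP => //= /eqP li; case: eqP => //= /eqP lj; apply/eqP/(ord3_third_uniq ij).
have := perm_flatten (perm_map A P).
by rewrite /= cats0.
Qed.

Section Triads.
Variable G : sgraph.
Implicit Types (u v x y z a b s : G) (p q S : seq G).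
Local Notation oadj := (@oadj G).

(** [S] stands for a vertex set, taken up to permutation. Disjoint unions are concatenations, and
    repetition is excluded once and for all by uniqueness of the full vertex list. *)
Definition spath x y S :=
  exists p, [/\ path oadj x p, last x p = y & perm_eq (x :: p) S].

Lemma spath1 x : spath x x [:: x].
Proof. by exists [::]. Qed.

Lemma spath_perm x y S S' : perm_eq S S' -> spath x y S -> spath x y S'.
Proof. by move=> e [p [h l /perm_trans h']]; exists p; split; rewrite ?h'. Qed.

Lemma spath_sym x y S : spath x y S -> spath y x S.
Proof.
case=> p [h l e]; exists (rev (belast x p)); split.
- by rewrite -l rev_path; apply: sub_path h => a b; rewrite oadj_sym.
- by rewrite -l; case: (p) => //= a b; rewrite rev_cons last_rcons.
- by rewrite -{1}l -rev_rcons -lastI perm_rev.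
Qed.

Lemma spath_cat (a b c d : G) S S' :
  spath a b S -> oadj b c -> spath c d S' -> spath a d (S ++ S').
Proof.
move=> [p [p1 p2 p3]] bc [q [q1 q2 q3]]; exists (p ++ c :: q); split.
- by rewrite cat_path p1 p2 /= bc.
- by rewrite last_cat.
- by rewrite -cat_cons perm_cat.
Qed.

Lemma spath_cons z a b S : oadj z a -> spath a b S -> spath z b (z :: S).
Proof. by move=> za h; apply: spath_cat (spath1 z) za h. Qed.

Lemma spath_rcons z a b S : oadj b z -> spath a b S -> spath a z (z :: S).
Proof.
by move=> za h; apply/spath_sym/(spath_cons _ (spath_sym h)); rewrite oadj_sym.
Qed.

Lemma spath_mem a b S : spath a b S -> a \in S /\ b \in S.
Proof.
by case=> p [_ <- e]; rewrite -!(perm_mem e) mem_head mem_last.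
Qed.

Implicit Types (t : 'I_3 -> G) (i j k l : 'I_3).

(** What a cycle needs when it enters the triad at [u] by an o-edge: one path leaves through
    terminal [j], and a second one connects the two remaining arcs. *)
Definition linked S t j u := exists S1 S2,
  [/\ perm_eq (S1 ++ S2) S, spath u (t j) S1 &
      forall k l, k != l -> k != j -> l != j -> spath (t k) (t l) S2].

(** By the last field, a vertex of [S] that is not a terminal is linked to at least two terminals;
    this is what restricts o-edges between two triads to terminals. *)
Record triad S t : Prop := Triad {
  triad_inj : injective t;
  triad_spath : forall i j, i != j -> spath (t i) (t j) S;
  triad_linked : forall i u, u \in S -> u != t i ->
    exists2 j, j != i & linked S t j u }.

Lemma triad_mem S t i : triad S t -> t i \in S.
Proof.
move=> T; have [j ij] := ord3_other i.
by case/spath_mem: (triad_spath T ij).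
Qed.

(** Only one unordered pair of indices avoids [j], so one path and its reverse suffice. *)
Lemma linked_intro S t j k l u S1 S2 :
  k != l -> k != j -> l != j ->
  perm_eq (S1 ++ S2) S -> spath u (t j) S1 -> spath (t k) (t l) S2 ->
  linked S t j u.
Proof.
move=> kl kj lj e h1 h2; exists S1, S2; split=> // k' l' kl' kj' lj'.
have [E|kk] := eqVneq k' k.
  rewrite E in kl' kj' *.
  by rewrite (ord3_third_uniq kj _ lj _ lj') // eq_sym.
have E : k' = l by apply: (ord3_third_uniq kj) => //; rewrite eq_sym.
rewrite E in kl' *; rewrite (ord3_third_uniq lj kl kj _ lj') 1?eq_sym //.
exact: spath_sym.
Qed.

(** Every vertex is a terminal, linked to itself by a trivial path while the opposite edge joins the
    other two. *)
Lemma triangle_triad S t : injective t ->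
  (forall i j, i != j -> oadj (t i) (t j)) ->
  (forall i j k, i != j -> k != i -> k != j -> perm_eq [:: t i; t j; t k] S) ->
  triad S t.
Proof.
move=> inj_t ot eS; split=> // [i j ij|i u].
  have [k /andP[ki kj]] := ord3_third ij.
  exists [:: t k; t j]; split=> //=; last by apply: eS; rewrite // eq_sym.
  by rewrite !ot // eq_sym.
have [j0 [k0 [e1 e2 e3]]] : exists j k, [/\ i != j, k != i & k != j].
  have [j ji] := ord3_other i; have [k /andP[kj ki]] := ord3_third ji.
  by exists j, k; rewrite eq_sym.
have L j : linked S t j (t j).
  have [k kj] := ord3_other j; have [l /andP[lk lj]] := ord3_third kj.
  apply: (@linked_intro _ _ _ k l _ [:: t j] [:: t k; t l]) => //; try by rewrite eq_sym.
  - by apply: eS => //; rewrite eq_sym.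
  - exact: spath1.
  - by exists [:: t l]; rewrite /= ot // eq_sym.
rewrite -(perm_mem (eS _ _ _ e1 e2 e3)) !inE => /or3P[] /eqP->; rewrite ?eqxx // => _.
  by exists j0; rewrite 1?eq_sym.
by exists k0.
Qed.

Definition upd t i z : 'I_3 -> G := fun j => if j == i then z else t j.

Lemma upd_inj S t i z : triad S t -> z \notin S -> injective (upd t i z).
Proof.
move=> T zS j k; rewrite /upd; case: eqP => [->|_]; case: eqP => [->|_] //.
- by move=> E; move: zS; rewrite E triad_mem.
- by move=> E; move: zS; rewrite -E triad_mem.
- exact: triad_inj T _ _.
Qed.

(** Exactly one of the two paths ends at [t i], and [z] is appended to it. *)
Lemma linked_upd S t i z j u : oadj (t i) z ->
  linked S t j u -> linked (z :: S) (upd t i z) j u.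
Proof.
move=> tz [S1 [S2 [e h1 h2]]].
have [E|ji] := eqVneq j i.
  subst j; exists (z :: S1), S2; split; first by perm_count.
    by rewrite /upd eqxx; apply: spath_rcons h1.
  by move=> k l kl ki li; rewrite /upd (negbTE ki) (negbTE li); apply: h2.
have [k /andP[ki kj]] := ord3_third ji.
apply: (@linked_intro _ _ _ k i _ S1 (z :: S2)) => //; try by rewrite eq_sym.
- by perm_count.
- by rewrite /upd (negbTE ji).
- rewrite /upd eqxx (negbTE kj); apply: spath_rcons tz _; apply: h2 => //.
  by rewrite eq_sym.
Qed.

(** The terminal [t i] advances to the next vertex [z] of its arc. The second o-neighbour [s] of [z]
    lets paths between the other two terminals pass through [z]. *)
Lemma triad_extend S t i z s : triad S t -> z \notin S -> oadj (t i) z ->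
  s \in S -> s != t i -> oadj z s -> triad (z :: S) (upd t i z).
Proof.
move=> T zS tz sS st zs; split; first exact: upd_inj T zS.
  have R k : k != i -> spath z (t k) (z :: S).
    move=> ki; apply: (spath_cons (a := t i)); first by rewrite oadj_sym.
    apply: triad_spath => //.
    by rewrite eq_sym.
  move=> k l kl; rewrite /upd.
  have [Ek|ki] := eqVneq k i; have [El|li] := eqVneq l i.
  - by rewrite Ek El eqxx in kl.
  - exact: R.
  - exact/spath_sym/R.
  (* Link [s] to [t j]; then [t m] ... [t i], [z], [s] ... [t j] spans the enlarged triad. *)
  have [j ji [S1 [S2 [e h1 h2]]]] := triad_linked T sS st.
  have [m /andP[mj mi]] := ord3_third ji.
  have H : spath (t m) (t j) (z :: S).
    apply: (spath_perm _ (spath_cat (h2 m i _ _ _) tz (spath_cons zs h1))) => //.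
      by perm_count.
    by rewrite eq_sym.
  have [E|kj] := eqVneq k j.
    rewrite E in kl *; rewrite (ord3_third_uniq ji mj mi _ li) 1?eq_sym //.
    exact: spath_sym.
  rewrite (ord3_third_uniq ji mj mi kj ki) in kl *.
  by rewrite (ord3_third_uniq mi _ ji _ li) // eq_sym.
move=> i0 u uS ui.
have [E|i0i] := eqVneq i0 i.
  rewrite {}E /upd eqxx in ui *; rewrite inE (negbTE ui) /= in uS.
  have [Eu|ut] := eqVneq u (t i); last first.
    by have [j ji L] := triad_linked T uS ut; exists j => //; apply: linked_upd.
  (* The former terminal [t i] needs a link avoiding index [i]: the same splitting gives [t i] ...
     [t m] and [z], [s] ... [t j]. *)
  have [j ji [S1 [S2 [e h1 h2]]]] := triad_linked T sS st.
  have [m /andP[mj mi]] := ord3_third ji.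
  exists m => //.
  apply: (@linked_intro _ _ _ i j _ S2 (z :: S1)) => //; try by rewrite eq_sym.
  - by perm_count.
  - by rewrite (negbTE mi) Eu; apply: h2 => //; rewrite eq_sym.
  - by rewrite eqxx (negbTE ji); apply: spath_cons zs h1.
move: uS; rewrite inE => /orP[/eqP->|uS].
  exists i; rewrite 1?eq_sym //.
  exists [:: z], S; split=> //; first by rewrite /upd eqxx; apply: spath1.
  move=> k l kl ki li; rewrite /upd (negbTE ki) (negbTE li).
  exact: triad_spath.
rewrite /upd (negbTE i0i) in ui.
by have [j ji L] := triad_linked T uS ui; exists j => //; apply: linked_upd.
Qed.

(** Two terminals advance at once. The o-edge from [z] to [z'] gives the paths [z], [z'], [t j] ...
    [t k] and [z'], [z], [t i] ... [t k], while [z], [t i] ... [t j], [z'] joins the new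
    terminals. *)
Lemma triad_extend2 S t i j z z' : triad S t -> i != j ->
  z \notin S -> z' \notin z :: S -> oadj (t i) z -> oadj (t j) z' -> oadj z z' ->
  triad (z' :: z :: S) (upd (upd t i z) j z').
Proof.
move=> T ij zS; rewrite inE negb_or => /andP[z'z z'S] tz tz' zz'.
have [k /andP[ki kj]] := ord3_third ij.
have ji : j != i by rewrite eq_sym.
have ti : upd (upd t i z) j z' i = z by rewrite /upd (negbTE ij) eqxx.
have tj : upd (upd t i z) j z' j = z' by rewrite /upd eqxx.
have tk : upd (upd t i z) j z' k = t k by rewrite /upd (negbTE ki) (negbTE kj).
have L m u : linked S t m u -> linked (z' :: z :: S) (upd (upd t i z) j z') m u.
  by move=> H; apply: linked_upd (linked_upd tz H); rewrite /upd (negbTE ji).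
have cases l : [\/ l = i, l = j | l = k].
  have [->|li] := eqVneq l i; first by constructor 1.
  have [->|lj] := eqVneq l j; first by constructor 2.
  by constructor 3; apply: (ord3_third_uniq ij).
have Rij : spath z z' (z' :: z :: S).
  apply: spath_rcons tz' _; apply: spath_cons (triad_spath T ij).
  by rewrite oadj_sym.
have Rik : spath z (t k) (z' :: z :: S).
  have jk : j != k by rewrite eq_sym.
  apply: (spath_perm _ (spath_cons zz' (spath_cons (a := t j) _ (triad_spath T jk)))).
    by perm_count.
  by rewrite oadj_sym.
have Rjk : spath z' (t k) (z' :: z :: S).
  apply: (spath_cons (a := z)); first by rewrite oadj_sym.
  apply: (spath_cons (a := t i)); first by rewrite oadj_sym.
  by apply: triad_spath => //; rewrite eq_sym.
split.
- move=> a b.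
  have tkz : t k != z by apply: contraNneq zS => <-; apply: triad_mem.
  have tkz' : t k != z' by apply: contraNneq z'S => <-; apply: triad_mem.
  case: (cases a) => ->; case: (cases b) => ->;
    rewrite ?ti ?tj ?tk // => E; by move: z'z tkz tkz'; rewrite E ?eqxx.
- move=> a b; case: (cases a) => ->; case: (cases b) => ->;
    rewrite ?ti ?tj ?tk ?eqxx //= => _; exact: spath_sym.
- move=> a u uS ua.
  move: uS; rewrite !inE => /or3P[/eqP Eu|/eqP Eu|uS].
  + exists j; first by apply: contraNneq ua => <-; rewrite Eu tj.
    apply: (@linked_intro _ _ _ i k _ [:: z'] (z :: S)) => //; try by rewrite eq_sym.
    * by rewrite tj Eu; apply: spath1.
    * rewrite ti tk; apply: (spath_cons (a := t i)); first by rewrite oadj_sym.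
      by apply: triad_spath => //; rewrite eq_sym.
  + exists i; first by apply: contraNneq ua => <-; rewrite Eu ti.
    apply: (@linked_intro _ _ _ j k _ [:: z] (z' :: S)) => //; try by rewrite eq_sym.
    * by perm_count.
    * by rewrite ti Eu; apply: spath1.
    * rewrite tj tk; apply: (spath_cons (a := t j)); first by rewrite oadj_sym.
      by apply: triad_spath => //; rewrite eq_sym.
  (* A former terminal is linked to [t k] by a spanning path of [S], leaving the o-edge from [z] to
     [z'] as second path. *)
  + have [Eu|ut] := eqVneq u (t a); last first.
      by have [m ma H] := triad_linked T uS ut; exists m => //; apply: L.
    have ak : a != k.
      by apply: contraNneq ua => E; rewrite Eu E tk.
    exists k; first by rewrite eq_sym.
    apply: (@linked_intro _ _ _ i j _ S [:: z; z']) => //; try by rewrite eq_sym.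
    * by perm_count.
    * by rewrite tk Eu; apply: triad_spath.
    * by rewrite ti tj; exists [:: z']; rewrite /= zz'.
Qed.

End Triads.

(** * Nets in claw-free tripods *)

Definition tri (T : Type) (a b c : T) (i : 'I_3) : T :=
  match val i with 0 => a | 1 => b | _ => c end.

Lemma tri_injective (T : eqType) (a b c : T) :
  a != b -> a != c -> b != c -> injective (tri a b c).
Proof.
move=> ab ac bc [[|[|[|//]]] Hi] [[|[|[|//]]] Hj]; rewrite /tri /= => E;
  apply: val_inj => //=; exfalso; move: ab ac bc; rewrite E ?eqxx //.
Qed.

Lemma tri_sym_rel (T : Type) (e : rel T) (a b c : T) (i j : 'I_3) :
  symmetric e -> e a b -> e a c -> e b c -> i != j ->
  e (tri a b c i) (tri a b c j).
Proof.
move=> es ab ac bc.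
by case: i j => [[|[|[|//]]] Hi] [[|[|[|//]]] Hj]; rewrite /tri //= es.
Qed.

Section Nets.
Variable G : sgraph.
Implicit Types (x y : 'I_3 -> G) (i j k : 'I_3).

(** Otherwise the leaves are pairwise nonadjacent and span an induced claw with [c], whose heavy
    pair must consist of two leaves. *)
Lemma claw_leaves (c : G) x : claw_o_heavy G -> injective x ->
  (forall i, adj c (x i)) -> exists i j, i != j /\ oadj (x i) (x j).
Proof.
move=> hG inj_x cx.
case E: [exists i, exists j, (i != j) && oadj (x i) (x j)].
  by have [i /existsP[j /andP[]]] := existsP E; exists i, j.
have N i j : i != j -> oadj (x i) (x j) -> False.
  by move=> ij o; move/existsP: E; apply; exists i; apply/existsP; exists j; rewrite ij.
have Na i j : adj (x i) (x j) = false.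
  have [->|ij] := eqVneq i j; first exact: adj_irr.
  by apply/negP => /adj_oadj /N; apply.
pose f (a : claw) : G := match a with inl _ => c | inr i => x i end.
have [|a [b]] := hG f.
  split=> [[a|i] [b|j]|[a|i] [b|j]] /=; rewrite ?adj_irr ?Na ?cx //.
  - by move=> _; rewrite !ord1.
  - by move=> E'; have := cx j; rewrite -E' adj_irr.
  - by move=> E'; have := cx i; rewrite E' adj_irr.
  - by move/inj_x->.
  - by rewrite adj_sym cx.
case=> ne na hv; exfalso; case: a b ne na hv => [a|i] [b|j] /=; rewrite ?eqxx ?cx //.
  by rewrite adj_sym cx.
move=> ne _ hv; apply: (@N i j); last by rewrite /oadj ne hv orbT.
by apply: contraNneq ne => ->.
Qed.

Variable F : {pred G}.

(** Injectivity follows from the adjacencies, as no two vertices of a net have the same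
    neighbours. *)
Definition net_in x y := [/\ forall i, x i \in F, forall i, y i \in F,
  forall i j, adj (x i) (x j) = (i != j),
  forall i j, adj (x i) (y j) = (i == j) &
  forall i j, adj (y i) (y j) = false].

(* Peeling the ends off the path [s] may give a leg several neighbours on [s];
   such a leg becomes a triangle vertex of the net, hence needs a pendant. *)
Record tripod (s : seq G) (z : 'I_3 -> G) : Prop := Tripod {
  tripod_sorted : sorted (@adj G) s;
  tripod_uniq : uniq s;
  tripod_sub : {subset s <= F};
  tripod_leg : forall i, z i \in F;
  tripod_leg_notin : forall i, z i \notin s;
  tripod_leg_inj : injective z;
  tripod_leg_adj : forall i j, adj (z i) (z j) = false;
  tripod_leg_has : forall i, has (adj (z i)) s;
  tripod_leg_pendant : forall i,
    {in s &, forall a b, adj (z i) a -> adj (z i) b -> a = b} \/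
    exists w, [/\ w \in F, w \notin s, adj w (z i),
      {in s, forall a, adj w a = false} & forall j, j != i -> adj w (z j) = false] }.

Hypothesis claw_free : forall c x, c \in F -> (forall i, x i \in F) ->
  injective x -> (forall i, adj c (x i)) ->
  exists i j, i != j /\ adj (x i) (x j).

Lemma tripod_rev s z : tripod s z -> tripod (rev s) z.
Proof.
case=> h1 h2 h3 h4 h5 h6 h7 h8 h9; split=> //.
- by rewrite rev_sorted; apply: sub_sorted h1 => a b; rewrite adj_sym.
- by rewrite rev_uniq.
- by move=> a; rewrite mem_rev => /h3.
- by move=> i; rewrite mem_rev.
- by move=> i; rewrite has_rev.
- move=> i; case: (h9 i) => [H|[w [w1 w2 w3 w4 w5]]]; [left|right].
    by move=> a b; rewrite !mem_rev; apply: H.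
  by exists w; split; rewrite ?mem_rev // => a; rewrite mem_rev; apply: w4.
Qed.

(** The obstruction to deleting an end [m] of the path: leg [i] would lose its only neighbour there,
    and [m] cannot replace it as a leg because leg [k] is adjacent to [m]. *)
Definition blocked (s : seq G) (z : 'I_3 -> G) m := exists i k,
  [/\ i != k, {in s, forall a, adj (z i) a -> a = m} & adj (z k) m].

(** Delete the end [m]. If some leg then has no neighbour left on the path and no other leg is
    adjacent to [m], the vertex [m] becomes a leg in its place. *)
Lemma tripod_shrink m b s z : tripod [:: m, b & s] z ->
  blocked [:: m, b & s] z m \/ exists z', tripod (b :: s) z'.
Proof.
set s' := b :: s; case=> h1 h2 h3 h4 h5 h6 h7 h8 h9.
have ss a : a \in s' -> a \in m :: s' by move=> h; rewrite inE h orbT.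
have [h1' [h2m h2']] : sorted (@adj G) s' /\ (m \notin s') /\ uniq s'.
  by move: h1 h2 => /= /andP[_ ->] /andP[-> ->].
have h3' : {subset s' <= F} by move=> a /ss /h3.
have h9' i : {in s' &, forall a b, adj (z i) a -> adj (z i) b -> a = b} \/
    exists w, [/\ w \in F, w \notin s', adj w (z i),
      {in s', forall a, adj w a = false} & forall j, j != i -> adj w (z j) = false].
  case: (h9 i) => [H|[w [w1 w2 w3 w4 w5]]]; [left|right].
    by move=> a c /ss ? /ss; apply: H.
  exists w; split=> //; first by apply: contra w2 => /ss.
  by move=> a /ss; apply: w4.
case E: [forall i, has (adj (z i)) s'].
  right; exists z; split=> // i; last by move/forallP: E.
  by apply: contra (h5 i) => /ss.
have [i ni] : exists i, ~~ has (adj (z i)) s'.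
  by apply/existsP; rewrite -negb_forall E.
have Ni : {in s', forall a, adj (z i) a = false}.
  by move=> a as'; apply: contraNF ni => ?; apply/hasP; exists a.
have h8' j : adj (z j) m || has (adj (z j)) s' by exact: h8.
have zim : adj (z i) m by move: (h8' i); rewrite (negbTE ni) orbF.
case E': [exists k, (i != k) && adj (z k) m].
  left; have [k /andP[ik km]] := existsP E'; exists i, k; split=> // a.
  by rewrite inE => /orP[/eqP//|/Ni ->].
have Nk k : k != i -> adj (z k) m = false.
  by rewrite eq_sym => ik; apply: contraFF E' => ?; apply/existsP; exists k; rewrite ik.
(* The replaced leg [z i] serves as pendant of the new leg [m]. *)
right; exists (upd z i m); split=> //.
- by move=> j; rewrite /upd; case: eqP => // _; apply: h3; apply: mem_head.
- move=> j; rewrite /upd; case: eqP => // _.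
  by apply: contra (h5 j) => /ss.
- move=> j k; rewrite /upd; case: eqP => [->|_]; case: eqP => [->|_] //.
  + by move=> E2; have := h5 k; rewrite -E2 mem_head.
  + by move=> E2; have := h5 j; rewrite E2 mem_head.
  + exact: h6.
- move=> j k; rewrite /upd; case: eqP => [_|/eqP ji]; case: eqP => [_|/eqP ki] //.
  + exact: adj_irr.
  + by rewrite adj_sym Nk.
  + by rewrite Nk.
- move=> j; rewrite /upd; case: eqP => [_|/eqP ji].
    by move: h1; rewrite /= => /andP[-> _].
  by move: (h8' j); rewrite Nk.
- move=> j; rewrite /upd; have [->|ji] := eqVneq j i.
    right; exists (z i); split=> //; first by apply: contra (h5 i) => /ss.
    by move=> k ki; rewrite (negbTE ki).
  case: (h9 j) => [H|[w [w1 w2 w3 w4 w5]]]; [left|right].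
    by move=> a c /ss ? /ss; apply: H.
  exists w; split=> //; first by apply: contra w2 => /ss.
    by move=> a /ss; apply: w4.
  by move=> k kj; case: eqP => _; [apply: w4; apply: mem_head|apply: w5].
Qed.

(** The legs attached only to [m] and only to [m'] are distinct, so the third leg [z k] is adjacent
    to both and has a pendant [w]. The net has triangle [m], [m'], [z k] and pendants [z i], [z i'],
    [w]. *)
Lemma blocked_net s z m m' : tripod s z -> m \in s -> m' \in s -> m != m' ->
  blocked s z m -> blocked s z m' -> exists x y, net_in x y.
Proof.
case=> h1 h2 h3 h4 h5 h6 h7 h8 h9 ms m's mm' [i [k [ik Ni km]]] [i' [k' [ik' Ni' km']]].
have zim : adj (z i) m by have /hasP[a as' za] := h8 i; rewrite -(Ni a).
have zim' : adj (z i') m' by have /hasP[a as' za] := h8 i'; rewrite -(Ni' a).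
have nim' : adj (z i) m' = false.
  by apply: contraNF mm' => /(Ni _ m's) ->.
have nim : adj (z i') m = false.
  by apply: contraNF mm' => /(Ni' _ ms) ->.
have ii' : i != i' by apply: contraTneq zim => ->; rewrite nim.
have ki' : k != i' by apply: contraTneq km => ->; rewrite nim.
have k'i : k' != i by apply: contraTneq km' => ->; rewrite nim'.
have ki : k != i by rewrite eq_sym.
have Ek : k' = k by apply: (ord3_third_uniq ii') => //; rewrite eq_sym.
subst k'.
case: (h9 k) => [H|[w [w1 w2 w3 w4 w5]]].
  by move: mm'; rewrite (H m m') ?eqxx.
(* Among the neighbours [w], [m], [m'] of [z k], only [m] and [m'] can be adjacent. *)
have adjm : adj m m'.
  have [||||a [b [ab]]] := @claw_free (z k) (tri w m m').
  - exact: h4.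
  - by move=> [[|[|[|//]]] ?]; rewrite /tri //=; apply: h3.
  - by apply: tri_injective => //; [apply: contraNneq w2 => ->|apply: contraNneq w2 => ->].
  - by move=> [[|[|[|//]]] ?]; rewrite /tri //= adj_sym.
  move: ab; case: a b => [[|[|[|//]]] ?] [[|[|[|//]]] ?]; rewrite /tri //= ?w4 //.
  - by rewrite adj_sym w4.
  - by rewrite adj_sym w4.
  - by rewrite adj_sym.
have cases l : [\/ l = i, l = i' | l = k].
  have [->|li] := eqVneq l i; first by constructor 1.
  have [->|lj] := eqVneq l i'; first by constructor 2.
  by constructor 3; apply: (ord3_third_uniq ii').
exists (fun l => if l == i then m else if l == i' then m' else z k).
exists (fun l => if l == k then w else z l).
have e1 := negbTE ii'; have e2 := negbTE ki; have e3 := negbTE ki'.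
have e1' : (i' == i) = false by rewrite eq_sym.
have e2' : (i == k) = false by rewrite eq_sym.
have e3' : (i' == k) = false by rewrite eq_sym.
have mz : adj m (z k) by rewrite adj_sym.
have mz' : adj m' (z k) by rewrite adj_sym.
have a1 : adj m' m by rewrite adj_sym.
have a2 : adj m (z i) by rewrite adj_sym.
have a3 : adj m' (z i') by rewrite adj_sym.
have a4 : adj m (z i') = false by rewrite adj_sym.
have a5 : adj m' (z i) = false by rewrite adj_sym.
have a6 : adj (z k) w by rewrite adj_sym.
have a7 : adj m w = false by rewrite adj_sym w4.
have a8 : adj m' w = false by rewrite adj_sym w4.
have a9 : adj (z i) w = false by rewrite adj_sym w5 // eq_sym.
have a10 : adj (z i') w = false by rewrite adj_sym w5 // eq_sym.
have a11 : adj w (z i) = false by rewrite adj_sym.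
have a12 : adj w (z i') = false by rewrite adj_sym.
have R := (eqxx, e1, e2, e3, e1', e2', e3', h7, adj_irr).
split.
- by move=> l; case: (cases l) => ->; rewrite ?R ?h4 //; apply: h3.
- by move=> l; case: (cases l) => ->; rewrite ?R.
- by move=> l l'; case: (cases l) => ->; case: (cases l') => ->;
  rewrite ?R ?adjm ?a1 ?mz ?mz' ?km ?km'.
- by move=> l l'; case: (cases l) => ->; case: (cases l') => ->;
  rewrite ?R ?a2 ?a3 ?a4 ?a5 ?a6 ?a7 ?a8.
- by move=> l l'; case: (cases l) => ->; case: (cases l') => ->;
  rewrite ?R ?a9 ?a10 ?a11 ?a12.
Qed.

(** Shrink the path from either end until both ends are blocked. A path of one vertex is impossible,
    since with the three legs it would be a claw. *)
Lemma tripod_net s z : tripod s z -> exists x y, net_in x y.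
Proof.
have [n] := ubnP (size s); elim: n => // n IH in s z *.
case: s => [|m [|b s]] lt_n T; first by have := tripod_leg_has T ord0.
  have [||||i [j [_]]] := @claw_free m z.
  - by apply: (tripod_sub T); rewrite mem_head.
  - exact: tripod_leg T.
  - exact: tripod_leg_inj T.
  - by move=> i; have := tripod_leg_has T i; rewrite /= orbF adj_sym.
  by rewrite (tripod_leg_adj T).
have [Bm|[z' /IH]] := tripod_shrink T; last by apply; rewrite /= in lt_n *; lia.
have [c [m' Er]] : exists c m', rev [:: m, b & s] = m' :: c.
  case: (rev _) (size_rev [:: m, b & s]) => // m' c _; by exists c, m'.
have sr : size (rev [:: m, b & s]) = (size s).+2 by rewrite size_rev.
have Tr := tripod_rev T; rewrite Er in Tr sr.
case: c => [|b' c] in Er Tr sr *; first by [].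
have [Bm'|[z' /IH]] := tripod_shrink Tr; last first.
  by apply; move: sr lt_n => /= -[->]; lia.
have sub a : a \in [:: m', b' & c] = (a \in [:: m, b & s]) by rewrite -Er mem_rev.
apply: (blocked_net T _ _ _ Bm (m' := m')).
- exact: mem_head.
- by rewrite -sub mem_head.
- have : m = last m' (b' :: c).
    by rewrite -[last _ _]/(last m (m' :: b' :: c)) -Er rev_cons last_rcons.
  move=> ->; move: (tripod_uniq Tr); rewrite /= => /andP[H _].
  by apply: contraNneq H => <-; apply: mem_last.
- case: Bm' => i [k [ik H km]]; exists i, k; split=> // a.
  by rewrite -sub; apply: H.
Qed.

(** A pair of degree sum at least n inside [F] is an edge of the net, and p-heaviness rules out the
    pendant edges. *)
Lemma net_in_heavy x y : net_p_heavy G -> net_in x y ->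
  {in F &, forall a b, oadj a b -> adj a b} ->
  exists i j, i != j /\ #|G| <= degree (x i) + degree (x j).
Proof.
move=> hG [xF yF xx xy yy] oF.
pose f (a : net) : G := if a.2 then y a.1 else x a.1.
have fF a : f a \in F by rewrite /f; case: ifP.
have fadj a b : adj (f a) (f b) = adj a b.
  by case: a b => [i []] [j []]; rewrite /f /= ?xx ?xy ?yy // adj_sym xy eq_sym.
have [|a [b [ne hv np]]] := hG f.
  split=> // -[i []] [j []]; rewrite /f /= => E.
  - by have := xy i j; rewrite -E xy eqxx => /esym/eqP->.
  - by have := xy j j; rewrite -E yy eqxx.
  - by have := xy i i; rewrite E yy eqxx.
  - by have := xx i j; rewrite -E adj_irr => /esym/negbFE/eqP->.
have : adj (f a) (f b) by apply: oF => //; rewrite /oadj ne hv orbT.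
rewrite fadj; case: a b ne hv np => [i []] [j []] //=.
- by move=> _ _ np /eqP E; case/eqP: (np j); rewrite E setUC.
- by move=> _ _ np /eqP E; case/eqP: (np j); rewrite E.
- by rewrite /f /= => _ hv _ ij; exists i, j.
Qed.

End Nets.

(** * Theta structures *)

Section Thetas.
Variable G : sgraph.
Implicit Types (u v a b : G) (S X Y r U : seq G).
Implicit Types (t : 'I_3 -> G) (A : 'I_3 -> seq G) (i j k l : 'I_3).

Lemma path_rev_rcons u v r :
  path (@adj G) u (rcons r v) -> path (@adj G) v (rcons (rev r) u).
Proof.
rewrite -rev_cons -{2}(last_rcons u r v) (_ : u :: r = belast u (rcons r v)).
  by rewrite rev_path => h; apply: sub_path h => a b; rewrite adj_sym.
by apply: (can_inj revK); apply: (@rcons_injl _ v); rewrite belast_rcons.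
Qed.

Lemma spath_arc a b u v r X Y : path (@adj G) u (rcons r v) ->
  spath a u X -> spath v b Y -> spath a b (X ++ r ++ Y).
Proof.
move=> ur [p [p1 p2 p3]] [q [q1 q2 q3]]; exists (p ++ rcons r v ++ q); split.
- rewrite !cat_path p1 p2 last_rcons q1 andbT /=.
  exact: sub_path (@adj_oadj G) _ _ ur.
- by rewrite !last_cat last_rcons.
- by rewrite -cats1 -!catA; perm_count.
Qed.

Definition no_spanning_ocycle U := forall a b, spath a b U -> ~~ oadj b a.

Lemma spath_close u v r X U : no_spanning_ocycle U ->
  path (@adj G) u (rcons r v) -> spath u v X -> perm_eq (X ++ r) U -> False.
Proof.
move=> NC ur uv e.
case: r => [|z r] in ur e *.
  rewrite cats0 in e; move/negP: (NC _ _ (spath_perm e uv)); apply.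
  by move: ur; rewrite /= andbT adj_sym => /adj_oadj.
move: ur => /= /andP[uz zr].
have lz : spath (last z r) z (z :: r).
  apply: spath_sym; exists r; split=> //.
  by move: zr; rewrite rcons_path => /andP[h _]; apply: sub_path (@adj_oadj G) _ _ h.
have vl : oadj v (last z r).
  by move: zr; rewrite rcons_path oadj_sym => /andP[_ /adj_oadj].
move/negP: (NC _ _ (spath_perm e (spath_cat uv vl lz))); apply.
by rewrite oadj_sym adj_oadj.
Qed.

(** A theta graph whose two branch vertices are replaced by triads; [A i] lists the interior of an
    arc. *)
Record theta U S S' t t' A : Prop := Theta {
  theta_triad : triad S t;
  theta_triad' : triad S' t';
  theta_arc : forall i, path (@adj G) (t i) (rcons (A i) (t' i));
  theta_perm : perm_eq (S ++ S' ++ flatten [seq A i | i <- enum 'I_3]) U }.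

Lemma theta_permE U S S' A i j k : i != j -> k != i -> k != j ->
  perm_eq (S ++ S' ++ flatten [seq A i | i <- enum 'I_3]) U =
  perm_eq (S ++ S' ++ A i ++ A j ++ A k) U.
Proof.
move=> ij ki kj; apply: permPl; rewrite !perm_cat2l.
exact: perm_ord3.
Qed.

Lemma theta_sym U S S' t t' A :
  theta U S S' t t' A -> theta U S' S t' t (fun i => rev (A i)).
Proof.
case=> T T' arc e; split=> // [i|]; first exact: path_rev_rcons.
have [i ij] := ord3_other ord0; have [k /andP[ki kj]] := ord3_third ij.
move: e; rewrite !(theta_permE _ _ _ _ ij ki kj) => e.
by rewrite /=; perm_count.
Qed.

(** If arc [i] had no interior, the other two arcs and spanning paths of the two triads would form
    an o-cycle through [U]. *)
Lemma theta_arc_nonempty U S S' t t' A i : no_spanning_ocycle U ->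
  theta U S S' t t' A -> A i <> [::].
Proof.
move=> NC [T T' arc e] Ai.
have [j ji] := ord3_other i; have [k /andP[kj ki]] := ord3_third ji.
rewrite (theta_permE _ _ _ _ ji kj ki) Ai in e.
have jk : j != k by rewrite eq_sym.
apply: (spath_close NC (arc j)
  (spath_arc (arc k) (triad_spath T jk) (triad_spath T' kj))).
by perm_count.
Qed.

(** If [j] and [l] differed and [m] were the third index, the o-cycle would run [u] ... [t j], arc
    [j], [t' j] ... [t' m], arc [m] backwards, [t m] ... [t l], arc [l], [t' l] ... [v], and back to
    [u]. *)
Lemma theta_cross U S S' t t' A u v j l : no_spanning_ocycle U ->
  theta U S S' t t' A -> oadj u v -> linked S t j u -> linked S' t' l v ->
  j = l.
Proof.
move=> NC [T T' arc e] uv [S1 [S2 [e1 p1 p2]]] [S1' [S2' [e1' p1' p2']]].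
apply/eqP/negPn/negP => jl.
have [m /andP[mj ml]] := ord3_third jl.
rewrite (theta_permE _ _ _ _ jl mj ml) in e.
have lm : l != m by rewrite eq_sym.
have lj : l != j by rewrite eq_sym.
have jm : j != m by rewrite eq_sym.
have H := spath_arc (arc j) p1 (spath_arc (path_rev_rcons (arc m)) (p2' j m jm jl ml)
  (spath_arc (arc l) (p2 m l ml mj lj) (spath_sym p1'))).
suff /NC : spath u v U by rewrite oadj_sym uv.
by apply: spath_perm H; perm_count.
Qed.

Lemma triad_some_linked S t u : triad S t -> u \in S -> exists j, linked S t j u.
Proof.
move=> T uS; have [j j0] := ord3_other ord0.
have [E|ne] := eqVneq u (t ord0); last first.
  by have [k _ ?] := triad_linked T uS ne; exists k.
have [|k _ ?] := triad_linked T uS (i := j); last by exists k.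
by apply: contra j0; rewrite E => /eqP/(triad_inj T)->.
Qed.

(* An o-edge between the triads together with the three arcs closes up to a
   cycle unless the two linkages pair the terminals in the same way. *)
Lemma theta_cross_terminal U S S' t t' A u v : no_spanning_ocycle U ->
  theta U S S' t t' A -> u \in S -> v \in S' -> oadj u v ->
  exists i, u = t i /\ v = t' i.
Proof.
move=> NC th uS vS uv; have [T T' _ _] := th.
have [j Lj] := triad_some_linked T uS; have [l Ll] := triad_some_linked T' vS.
have E := theta_cross NC th uv Lj Ll; subst l; exists j.
split; apply/eqP/negPn/negP => ne.
  have [k kj Lk] := triad_linked T uS ne.
  by rewrite (theta_cross NC th uv Lk Ll) eqxx in kj.
have [k kj Lk] := triad_linked T' vS ne.
by rewrite -(theta_cross NC th uv Lj Lk) eqxx in kj.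
Qed.

Hypothesis claws : claw_o_heavy G.
Hypothesis nets : net_p_heavy G.

Lemma maximal_theta_heavy U S S' t t' A : uniq U -> no_spanning_ocycle U ->
  theta U S S' t t' A ->
  (forall S1 S1' t1 t1' A1, theta U S1 S1' t1 t1' A1 ->
     size S1 + size S1' <= size S + size S') ->
  exists u v, [/\ u \in S, v \in S, u != v & #|G| <= degree u + degree v].
Proof.
move=> Uu NC th maxi; have [T T' arc e] := th.
case E: [exists u in S, exists v in S, (u != v) && (#|G| <= degree u + degree v)].
  have [u /andP[uS /existsP[v /and3P[vS uv hv]]]] := existsP E; by exists u, v.
have nohv u v : u \in S -> v \in S -> u != v -> #|G| <= degree u + degree v -> False.
  move=> uS vS uv hv; move/existsP: E; apply; exists u; rewrite uS.
  by apply/existsP; exists v; rewrite vS uv.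
(* The default [t i] is never reached, as the arcs are nonempty. *)
pose z i := head (t i) (A i); pose B i := behead (A i).
have Az i : A i = z i :: B i.
  by have := theta_arc_nonempty NC th (i := i); rewrite /z /B; case: (A i).
have tz i : adj (t i) (z i) by have := arc i; rewrite Az /= => /andP[].
have arcB i : path (@adj G) (z i) (rcons (B i) (t' i)).
  by have := arc i; rewrite Az /= => /andP[].
have zS i : z i \notin S.
  have [j ji] := ord3_other i; have [k /andP[kj ki]] := ord3_third ji.
  have ij : i != j by rewrite eq_sym.
  move: e; rewrite (theta_permE _ _ _ _ ij ki kj) Az => /perm_uniq; rewrite Uu.
  rewrite cat_uniq => /and3P[_ H _]; apply: contra H => H; apply/hasP.
  by exists (z i) => //; rewrite !mem_cat inE eqxx !orbT.
have z_neq i j : i != j -> z i != z j.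
  move=> ij; have [k /andP[ki kj]] := ord3_third ij.
  move: e; rewrite (theta_permE _ _ _ _ ij ki kj) !Az => /perm_uniq; rewrite Uu.
  rewrite !cat_uniq => /and3P[_ _ /and3P[_ _ /and3P[_ H _]]].
  apply: contra H => /eqP H; apply/hasP.
  by exists (z i); rewrite ?mem_head // H mem_head.
(* Such an o-edge would let [triad_extend] move [z i] from its arc into the triad. *)
have no1 i s : s \in S -> s != t i -> ~~ oadj (z i) s.
  move=> sS st; apply/negP => zs.
  have [j ji] := ord3_other i; have [k /andP[kj ki]] := ord3_third ji.
  have ij : i != j by rewrite eq_sym.
  have : theta U (z i :: S) S' (upd t i (z i)) t' (fun l => if l == i then B i else A l).
    split=> //.
    - exact: triad_extend (zS i) (adj_oadj (tz i)) sS st zs.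
    - by move=> l; rewrite /upd; case: eqP => [->|].
    - rewrite (theta_permE _ _ _ _ ij ki kj) eqxx (negbTE ji) (negbTE ki).
      move: e; rewrite (theta_permE _ _ _ _ ij ki kj) Az => e; clear -e.
      by perm_count.
  by move/maxi => /=; clear; lia.
(* Likewise, [triad_extend2] would absorb both [z i] and [z j]. *)
have no2 i j : i != j -> ~~ oadj (z i) (z j).
  move=> ij; apply/negP => zz; have [k /andP[ki kj]] := ord3_third ij.
  have ji : j != i by rewrite eq_sym.
  pose A1 l := if l == i then B i else if l == j then B j else A l.
  have : theta U (z j :: z i :: S) S' (upd (upd t i (z i)) j (z j)) t' A1.
    split=> //.
    - apply: triad_extend2 => //; rewrite ?adj_oadj //.
      by rewrite inE negb_or zS z_neq.
    - move=> l; rewrite /upd /A1; case: (eqVneq l j) => [->|lj].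
        by rewrite (negbTE ji).
      by case: eqP => [->|].
    - rewrite (theta_permE _ _ _ _ ij ki kj) /A1 !eqxx (negbTE ji) (negbTE ki) (negbTE kj).
      move: e; rewrite (theta_permE _ _ _ _ ij ki kj) !Az => e; clear -e.
      by perm_count.
  by move/maxi => /=; clear; lia.
(* The triad with its pendants: in [F] the only o-neighbour of [z i] is [t i], so o-adjacency and
   adjacency agree and [F] is claw-free. *)
pose F : {pred G} := [pred x | (x \in S) || [exists i, x == z i]].
have FS x : x \in S -> x \in F by rewrite inE => ->.
have Fz i : z i \in F by rewrite inE; apply/orP; right; apply/existsP; exists i.
have FP x : x \in F -> x \in S \/ exists i, x = z i.
  by rewrite inE => /orP[|/existsP[i /eqP ->]]; [left|right; exists i].
have zF i x : x \in F -> oadj (z i) x -> x = t i.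
  move=> /FP[xS|[j ->]] o.
    by apply/eqP; apply: contraLR o; apply: no1.
  have [Eij|ij] := eqVneq i j; last by rewrite (negbTE (no2 _ _ ij)) in o.
  by rewrite Eij /oadj eqxx in o.
have oF : {in F &, forall a b, oadj a b -> adj a b}.
  move=> a b aF bF; case/FP: (aF) => [aS|[i ->]].
    case/FP: (bF) => [bS|[i ->]].
      by case/andP=> ab /orP[//|/(nohv _ _ aS bS ab)].
    by rewrite oadj_sym => /zF->.
  by move/zF->; rewrite // adj_sym.
have cF c x : c \in F -> (forall i, x i \in F) -> injective x ->
    (forall i, adj c (x i)) -> exists i j, i != j /\ adj (x i) (x j).
  move=> _ xF inj_x cx; have [i [j [ij o]]] := claw_leaves claws inj_x cx.
  by exists i, j; split=> //; apply: oF.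
have [j j0] := ord3_other ord0.
(* A spanning path of [S] passes through all three terminals, so it carries the legs [z], each with
   a single neighbour on it. *)
have [p [p1 p2 p3]] := triad_spath T j0.
have pS x : x \in t j :: p = (x \in S) by rewrite (perm_mem p3).
have tp : tripod F (t j :: p) z.
  split=> //.
  - have : all (mem F) (t j :: p) by apply/allP => x; rewrite pS => /FS.
    rewrite /=; move: p1; clear -oF.
    elim: p (t j) => //= b p IH a /andP[ab bp] /and3P[aF bF pF].
    by rewrite oF //= IH // bF.
  - rewrite (perm_uniq p3); move: e => /perm_uniq; rewrite Uu.
    by rewrite cat_uniq => /andP[].
  - by move=> x; rewrite pS => /FS.
  - by move=> i; rewrite pS.
  - by move=> i k Ez; apply/eqP; apply: contraTT isT => /z_neq; rewrite Ez eqxx.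
  - move=> i k; have [->|ik] := eqVneq i k; first exact: adj_irr.
    by apply: contraNF (no2 _ _ ik) => /adj_oadj.
  - move=> i; apply/hasP; exists (t i); last by rewrite adj_sym.
    by rewrite pS triad_mem.
  - move=> i; left => a b; rewrite !pS => /FS aF /FS bF /adj_oadj /zF -> //.
    by move/adj_oadj/zF->.
have [x [y N]] := tripod_net cF tp.
have [i [k [ik hv]]] := net_in_heavy nets N oF.
have [xF yF xx xy yy] := N.
(* If a triangle vertex were [z m], the other two would both equal [t m]. *)
have xS l : x l \in S.
  case/FP: (xF l) => // -[m Em]; exfalso.
  have [l1 ll1] := ord3_other l; have [l2 /andP[l21 l2l]] := ord3_third ll1.
  have E1 : x l1 = t m by apply: zF => //; rewrite -Em adj_oadj // xx eq_sym.
  have E2 : x l2 = t m by apply: zF => //; rewrite -Em adj_oadj // xx eq_sym.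
  by have := xx l1 l2; rewrite E1 E2 adj_irr eq_sym l21.
exfalso; apply: (nohv (x i) (x k)) => //.
by apply: adj_neq; rewrite xx.
Qed.

Lemma no_theta U S S' t t' A : uniq U -> no_spanning_ocycle U ->
  ~ theta U S S' t t' A.
Proof.
move=> Uu NC.
(* Induction on the number of vertices outside both triads; the induction hypothesis refutes any
   larger pair of triads, so the given one is maximal. *)
have [n] := ubnP (size U - (size S + size S')); elim: n => // n IH in S S' t t' A *.
move=> lt_n th.
have bound S1 S1' t1 t1' A1 : theta U S1 S1' t1 t1' A1 -> size S1 + size S1' <= size U.
  by case=> _ _ _ /perm_size; rewrite !size_cat => <-; rewrite addnA leq_addr.
have maxi S1 S1' t1 t1' A1 : theta U S1 S1' t1 t1' A1 ->
    size S1 + size S1' <= size S + size S'.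
  move=> th1; rewrite leqNgt; apply/negP => lt.
  by apply: (IH _ _ _ _ _ _ th1); have := bound _ _ _ _ _ th1; lia.
have [u1 [u2 [u1S u2S u12 hu]]] := maximal_theta_heavy Uu NC th maxi.
have [|v1 [v2 [v1S v2S v12 hv]]] := maximal_theta_heavy Uu NC (theta_sym th).
  by move=> *; rewrite (addnC (size S')); apply: maxi; eassumption.
have dis x y : x \in S -> y \in S' -> x != y.
  move=> xS yS; case: th => _ _ _ /perm_uniq; rewrite Uu !cat_uniq.
  case/and3P=> _ H _; apply: contra H => /eqP E; apply/hasP.
  by exists x => //; rewrite mem_cat E yS.
have cr x y : x \in S -> y \in S' -> #|G| <= degree x + degree y ->
    exists i, x = t i /\ y = t' i.
  move=> xS yS h; apply: (theta_cross_terminal NC th) => //.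
  by rewrite /oadj dis // h orbT.
have [T T' _ _] := th.
have inj := triad_inj T; have inj' := triad_inj T'.
(* Pairs between the triads with degree sum at least n form a matching, because each joins [t i] to
   [t' i]. *)
have excl x y y' : x \in S -> y \in S' -> y' \in S' -> y != y' ->
   #|G| <= degree x + degree y -> #|G| <= degree x + degree y' -> False.
  move=> xS yS yS' ne /(cr _ _ xS yS)[i [-> ei]] /(cr _ _ _ yS')[|j [/inj <- ej]].
    exact: triad_mem.
  by rewrite ei ej eqxx in ne.
have excl' x x' y : x \in S -> x' \in S -> y \in S' -> x != x' ->
   #|G| <= degree x + degree y -> #|G| <= degree x' + degree y -> False.
  move=> xS xS' yS ne /(cr _ _ xS yS)[i [ei ->]] /(cr _ _ xS')[|j [ej /inj' E]].
    exact: triad_mem.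
  by rewrite ei ej E eqxx in ne.
have C1 := excl u1 v1 v2 u1S v1S v2S v12.
have C2 := excl u2 v1 v2 u2S v1S v2S v12.
have C3 := excl' u1 u2 v1 u1S u2S v1S u12.
have C4 := excl' u1 u2 v2 u1S u2S v2S u12.
(* The four degrees add up to at least 2n, so each of the two ways to pair the [u]s with the [v]s
   contains a heavy sum. Two such sums, one from each pairing, share a vertex. *)
case: (leqP #|G| (degree u1 + degree v1)) => h11.
  case: (leqP #|G| (degree u1 + degree v2)) => h12; first exact: C1.
  case: (leqP #|G| (degree u2 + degree v1)) => h21; first exact: C3.
  lia.
case: (leqP #|G| (degree u2 + degree v2)) => h22; last lia.
case: (leqP #|G| (degree u1 + degree v2)) => h12; first exact: C4.
case: (leqP #|G| (degree u2 + degree v1)) => h21; first exact: C2.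
lia.
Qed.

End Thetas.

(** * Longest cycles *)

Section LongestCycle.
Variable G : sgraph.
Implicit Types (x y z : G) (c s r U : seq G).

(** An edge counts as a [ucycle] of size 2, so the maximum exists and is at least 2. *)
Lemma longest_cycle x y : adj x y ->
  exists c, [/\ ucycle (@adj G) c, 1 < size c &
                forall c', ucycle (@adj G) c' -> size c' <= size c].
Proof.
move=> xy; pose P n := [exists c : n.-tuple G, ucycleb (@adj G) c].
have PI c : ucycle (@adj G) c -> P (size c).
  by move=> h; apply/existsP; exists (in_tuple c).
have xyc : ucycle (@adj G) [:: x; y].
  by rewrite /ucycle /= xy adj_sym xy inE (adj_neq xy).
have exP : exists n, P n by exists 2; apply: (PI _ xyc).
have ubP n : P n -> n <= #|G|.
  case/existsP=> c /andP[_ /card_uniqP]; rewrite size_tuple => <-.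
  exact: max_card.
case: (ex_maxnP exP ubP) => n /existsP[c uc] maxn.
exists c; split; rewrite ?size_tuple //; first exact: (maxn _ (PI _ xyc)).
by move=> c' /PI /maxn.
Qed.

(** An o-cycle on three or more vertices is covered by a cycle of [G]; smaller ones are bounded by
    [1 < m]. *)
Lemma ocycle_bound m : 1 < m ->
  (forall c, ucycle (@adj G) c -> size c <= m) ->
  forall c, ucycle (@oadj G) c -> size c <= m.
Proof.
move=> m1 H [|x [|y [|z s]]] oc //; first exact: ltnW.
have [//|c [/H h sub]] := ocycle_cover oc.
by apply: leq_trans h; apply: uniq_leq_size => //; case/andP: oc.
Qed.

Variable m : nat.
Hypothesis claws : claw_o_heavy G.
Hypothesis nets : net_p_heavy G.
Hypothesis omax : forall c, ucycle (@oadj G) c -> size c <= m.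

Lemma spath_path x s : path (@adj G) x s -> spath x (last x s) (x :: s).
Proof. by move=> h; exists s; split=> //; apply: sub_path (@adj_oadj G) _ _ h. Qed.

Lemma triangle_triad_tri x y z : x != y -> x != z -> y != z ->
  oadj x y -> oadj x z -> oadj y z -> triad [:: x; y; z] (tri x y z).
Proof.
move=> xy xz yz oxy oxz oyz; apply: triangle_triad.
- exact: tri_injective.
- move=> i j; exact: tri_sym_rel (@oadj_sym G) oxy oxz oyz.
move=> i j k ij ki kj; pose A l := [:: tri x y z l].
have e := perm_ord3 A ij ki kj; rewrite perm_sym in e.
exact: perm_trans e
  (perm_ord3 A (i := Ordinal (isT : 0 < 3)) (j := Ordinal (isT : 1 < 3))
     (k := Ordinal (isT : 2 < 3)) isT isT isT).
Qed.

Lemma no_spanning_ocycle_gt U : uniq U -> m < size U -> no_spanning_ocycle U.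
Proof.
move=> Uu lt a b [p [p1 p2 p3]]; apply/negP => ba.
have : size (a :: p) <= m.
  by apply: omax; rewrite /ucycle /= rcons_path p1 p2 ba -/(uniq (a :: p)) (perm_uniq p3).
by rewrite (perm_size p3) leqNgt lt.
Qed.

(** Consider the neighbours of [x] formed by [x1] and its two neighbours on the cycle. An o-edge
    from [x1] to either of the latter would insert [x1] into the cycle, so those two are
    o-adjacent. *)
Lemma neighbours_oadj x x1 s : ucycle (@adj G) (x :: s) -> size s = m.-1 ->
  1 < size s -> x1 \notin x :: s -> adj x x1 -> oadj (head x s) (last x s).
Proof.
case: s => [|a s] //= /andP[/= /andP[xa sx] Us] sm s0 x1s xx1.
have osx : path (@oadj G) a (rcons s x) by apply: sub_path (@adj_oadj G) _ _ sx.
have Ux1 : uniq [:: x, x1, a & s].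
  move: Us x1s; rewrite /= !inE !negb_or => /andP[/andP[-> ->] ->] /and3P[].
  by rewrite eq_sym => -> -> ->.
have lx : oadj (last a s) x by move: osx; rewrite rcons_path => /andP[].
have os : path (@oadj G) a s by move: osx; rewrite rcons_path => /andP[].
have ab : a != last a s.
  move: s0 Us; case: (s) => //= b s' _ /and3P[_ H _].
  by apply: contraNneq H => ->; apply: mem_last.
have sz : m < (size s).+3 by clear -sm; lia.
have n1 : ~~ oadj x1 a.
  apply/negP => o; have := @omax [:: x, x1, a & s].
  rewrite /ucycle Ux1 /= adj_oadj //= o osx => /(_ isT).
  by rewrite leqNgt sz.
have n2 : ~~ oadj x1 (last a s).
  apply/negP => o; have := @omax [:: x1, x, a & s].
  rewrite /ucycle -[[:: x1, x, a & s]]/([:: x1] ++ [:: x] ++ (a :: s)).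
  rewrite uniq_catCA /= -/(uniq [:: x, x1, a & s]) Ux1.
  rewrite oadj_sym adj_oadj //= adj_oadj //= rcons_path os oadj_sym o => /(_ isT).
  by rewrite leqNgt sz.
have [||i [j [ij]]] := @claw_leaves G x (tri x1 a (last a s)) claws.
- apply: tri_injective => //; first by apply: contraNneq x1s => ->; rewrite !inE eqxx orbT.
  by apply: contraNneq x1s => ->; rewrite inE mem_last orbT.
- move=> [[|[|[|//]]] ?]; rewrite /tri //= adj_sym.
  by move: sx; rewrite rcons_path => /andP[].
move: ij; case: i j => [[|[|[|//]]] ?] [[|[|[|//]]] ?]; rewrite /tri //= => _ o;
  first [by rewrite o in n1 | by rewrite o in n2 | by rewrite oadj_sym o in n1
        | by rewrite oadj_sym o in n2 | by rewrite oadj_sym].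
Qed.

(** The cycle and the ear [r] form a theta graph. Its branch vertices [x] and [y], each with its two
    neighbours on the cycle, are the initial triads. *)
Lemma longest_cycle_no_ear x y s r : ucycle (@adj G) (x :: s) -> size (x :: s) = m ->
  y \in s -> r != [::] -> uniq r -> {in r, forall v, v \notin x :: s} ->
  path (@adj G) x (rcons r y) -> False.
Proof.
move=> uc sm ys r0 Ur rs xry.
case/splitPr: ys => s1 s2 in uc sm rs *.
set U := x :: s1 ++ y :: s2 ++ r.
have [cyc Uc] := andP uc.
have Uu : uniq U.
  have -> : U = (x :: s1 ++ y :: s2) ++ r by rewrite /U /= -catA.
  rewrite cat_uniq Uc Ur andbT /=; apply/hasPn => v vr; exact: rs.
have sU : m < size U.
  rewrite -sm /U /= !size_cat /= !size_cat; case: (r) r0 => //= *; lia.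
have NC := no_spanning_ocycle_gt Uu sU.
have [xs1 s2x] : path (@adj G) x (rcons s1 y) /\ path (@adj G) y (rcons s2 x).
  by move: cyc; rewrite /= rcons_cat cat_path /= => /and3P[h1 h2 ->]; rewrite rcons_path h1 h2.
have xry' := path_rev_rcons xry.
have xs1' := path_rev_rcons xs1; have s2x' := path_rev_rcons s2x.
have spx (v : G) : spath v v [:: v] := spath1 v.
(* If [x] and [y] were consecutive on the cycle, the ear could replace the edge between them. *)
have s1n : s1 != [::].
  apply/eqP => E; subst s1.
  apply: (spath_close NC s2x' (spath_arc xry (spx x) (spx y))).
  by rewrite /U; perm_count.
have s2n : s2 != [::].
  apply/eqP => E; subst s2.
  apply: (spath_close NC xs1 (spath_arc xry (spx x) (spx y))).
  by rewrite /U; perm_count.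
have sm' : size (s1 ++ y :: s2) = m.-1 by rewrite -sm.
have s1gt : 0 < size s1 by rewrite lt0n size_eq0.
have s2gt : 0 < size s2 by rewrite lt0n size_eq0.
have ox : oadj (head x s1) (last y s2).
  case Er: r r0 => [|x1 r'] // _; rewrite {}Er in rs xry.
  have := @neighbours_oadj x x1 _ uc sm'; rewrite last_cat /=.
  have -> : head x (s1 ++ y :: s2) = head x s1 by case: (s1) s1n.
  apply; first by rewrite size_cat addnS ltnS addn_gt0 s1gt.
    by apply: rs; rewrite mem_head.
  by move: xry => /= /andP[].
have oy : oadj (head y s2) (last x s1).
  have uc' : ucycle (@adj G) (y :: s2 ++ x :: s1).
    rewrite /ucycle -cat_cons -rot_size_cat rot_uniq rot_cycle.
    exact: uc.
  have sm'' : size (s2 ++ x :: s1) = m.-1.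
    by rewrite -sm' !size_cat /=; clear; lia.
  have [r' [y1 Er]] : exists r' y1, r = rcons r' y1.
    by case/lastP: (r) r0 => // r' y1; exists r', y1.
  rewrite {}Er in rs xry.
  have := @neighbours_oadj y y1 _ uc' sm''; rewrite last_cat /=.
  have -> : head y (s2 ++ x :: s1) = head y s2 by case: (s2) s2n.
  apply; first by rewrite size_cat addnS ltnS addn_gt0 s2gt.
    have := rs y1; rewrite mem_rcons mem_head => /(_ isT); apply: contra.
    by rewrite -!cat_cons !mem_cat orbC.
  by move: xry; rewrite rcons_path last_rcons adj_sym => /andP[].
have xy := spath_arc xry (spx x) (spx y).
case: s1 => // c1 s1' in U Uu sU NC uc sm rs cyc Uc xs1 xs1' s1n sm' s1gt ox oy *.
case: s2 => // c3 s2' in U Uu sU NC uc sm rs cyc Uc s2x s2x' s2n sm' s2gt ox oy *.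
rewrite /= in ox oy.
have [yc3 ps2] : oadj y c3 /\ path (@adj G) c3 s2'.
  by move: s2x; rewrite /= rcons_path => /and3P[/adj_oadj].
have [xc1 ps1] : oadj x c1 /\ path (@adj G) c1 s1'.
  by move: xs1; rewrite /= rcons_path => /and3P[/adj_oadj].
have c4x : oadj (last c3 s2') x.
  by move: s2x; rewrite /= rcons_path => /and3P[_ _ /adj_oadj].
have c2y : oadj (last c1 s1') y.
  by move: xs1; rewrite /= rcons_path => /and3P[_ _ /adj_oadj].
(* If [c1] is the only vertex of its segment, the triangles would share it; then [x], [r], [y],
   [c1], [c3] ... [c4] closes up directly. *)
case/lastP: s1' => [|r1 c2]
  in U Uu sU NC uc sm rs cyc Uc xs1 xs1' s1n sm' s1gt ox oy c2y ps1 *.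
  have yc1 : oadj y c1 by rewrite oadj_sym.
  have c13 : oadj c1 c3 by rewrite oadj_sym.
  have H := spath_cat (spath_cat xy yc1 (spx c1)) c13 (spath_path ps2).
  have /NC : spath x (last c3 s2') U by apply: spath_perm H; rewrite /U; perm_count.
  by rewrite c4x.
rewrite !last_rcons in oy c2y.
(* If [c3] is alone on its segment, [x], [r], [y], [c2] ... [c1], [c3] closes up. *)
case/lastP: s2' => [|r2 c4]
  in U Uu sU NC uc sm rs cyc Uc s2x s2x' s2n sm' s2gt ox oy c4x ps2 *.
  have yc2 : oadj y c2 by rewrite oadj_sym.
  have P1 := spath_sym (spath_path ps1); rewrite last_rcons in P1.
  have H := spath_cat (spath_cat xy yc2 P1) ox (spx c3).
  have /NC : spath x c3 U by apply: spath_perm H; rewrite /U; perm_count.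
  by rewrite c4x.
rewrite !last_rcons in ox c4x.
have Uu' : uniq ([:: x; c1; c4; y; c2; c3] ++ r1 ++ r2 ++ r).
  by rewrite -(perm_uniq (s1 := U)) // /U -!cats1; perm_count.
have [xc1n xc4n c14n yc2n yc3n] :
    [/\ x != c1, x != c4, c1 != c4, y != c2 & y != c3].
  move: Uu'; rewrite cat_uniq => /andP[].
  rewrite /= !inE !negb_or.
  case/and5P=> /and5P[-> -> _ _ _] /and4P[-> _ _ _] _ /andP[-> ->] _ _.
  by split.
have c23n : c2 != c3.
  move: Uu'; rewrite cat_uniq => /andP[].
  by rewrite /= !inE => /and5P[_ _ _ _ /andP[]].
have T1 : triad [:: c1; c4; x] (tri c1 c4 x).
  by apply: triangle_triad_tri => //; rewrite 1?eq_sym // oadj_sym.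
have T2 : triad [:: c2; c3; y] (tri c2 c3 y).
  by apply: triangle_triad_tri => //; rewrite 1?eq_sym // oadj_sym.
(* The arcs run from [c1] to [c2], from [c4] to [c3] against the order of the cycle, and from [x] to
   [y] along the ear. *)
apply: (@no_theta G claws nets U _ _ _ _ (tri r1 (rev r2) r) Uu NC (Theta T1 T2 _ _)).
- move=> [[|[|[|//]]] ?]; rewrite /tri //=.
  apply: path_rev_rcons; by move: ps2.
- rewrite (theta_permE _ _ _ _ (i := Ordinal (isT : 0 < 3)) (j := Ordinal (isT : 1 < 3))
     (k := Ordinal (isT : 2 < 3)) isT isT isT) /tri /=.
  by rewrite /U -!cats1; perm_count.
Qed.

End LongestCycle.

(** * Ears of a longest cycle from 2-connectivity *)

Theorem theorem17 (G : sgraph) :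
  k_connected 2 G -> claw_o_heavy G -> net_p_heavy G -> hamiltonian G.
Proof.
move=> [G2 conn] claws nets.
have con x u v : u != x -> v != x ->
    exists p, [/\ path (@adj G) u p, last u p = v & x \notin p].
  move=> ux vx; have [|_ H] := conn [set x]; first by rewrite cards1.
  have uS : u \in ~: [set x] by rewrite !inE.
  have vS : v \in ~: [set x] by rewrite !inE.
  have /connectP[p pp lp] := H (Sub u uS) (Sub v vS).
  exists (map val p); split.
  - by rewrite -[u]/(val (Sub u uS : {x : G | _})) path_map.
  - by rewrite -[u]/(val (Sub u uS : {x : G | _})) last_map -lp.
  - by apply/mapP => -[w _ E]; have := valP w; rewrite -E !inE eqxx.
(* Since n > 2, some third vertex can be deleted, which leaves a connected graph containing [u] and
   [v]. *)
have con2 u v : u != v -> exists p, path (@adj G) u p /\ last u p = v.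
  move=> uv; have [x] : exists x, x \in ~: [set u; v].
    by apply/card_gt0P; have := cardsC [set u; v]; rewrite cards2 uv; lia.
  rewrite !inE negb_or ![x == _]eq_sym => /andP[ux vx].
  by have [p [p1 p2 _]] := con x u v ux vx; exists p.
have [u [v uv]] : exists u v : G, u != v.
  have /card_gt1P[u [v [_ _ uv]]] : 1 < #|G| by exact: ltnW.
  by exists u, v.
have [a [b ab]] : exists a b : G, adj a b.
  have [[|b p] [/= pp lp]] := con2 u v uv; first by rewrite lp eqxx in uv.
  by case/andP: pp => ub _; exists u, b.
have [c [uc c1 cmax]] := longest_cycle ab.
have omax := ocycle_bound c1 cmax.
have [call|] := boolP [forall w, w \in c].
  exists c; split=> //; last by move=> w; apply: (forallP call).
  apply: leq_trans G2 _; rewrite cardE; apply: uniq_leq_size (enum_uniq _) _.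
  by move=> w _; apply: (forallP call).
rewrite negb_forall => /existsP[w wc]; exfalso.
have [w0 w0c] : exists w0, w0 \in c.
  by case: (c) c1 => // w0 s _; exists w0; rewrite mem_head.
have [|p [pp lp]] := con2 w0 w; first by apply: contraNneq wc => <-.
(* Hitting the complement of the cycle for the first time yields an edge from [x0] on the cycle to
   [x1] off it. *)
have [||q [x1 [q1 x1c q2 _]]] := @first_hit _ (@adj G) [predC mem c] w0 p _ _ pp.
- by rewrite /= w0c.
- by rewrite /= lp.
pose x0 := last w0 q.
have x0c : x0 \in c.
  have /allP/(_ x0 (mem_last _ _)) := q2; by rewrite /= negbK.
have x01 : adj x0 x1 by move: q1; rewrite rcons_path => /andP[].
have [n s Erot] := rot_to x0c.
have cs y : (y \in c) = (y \in x0 :: s) by rewrite -Erot mem_rot.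
have ss : size (x0 :: s) = size c by rewrite -Erot size_rot.
have uc' : ucycle (@adj G) (x0 :: s).
  by rewrite -Erot /ucycle rot_cycle rot_uniq.
have [y ys] : exists y, y \in s.
  by case: (s) ss c1 => [<-|y s' _ _] //; exists y; rewrite mem_head.
have yx0 : y != x0.
  by case/andP: uc' => _ /= /andP[H _]; apply: contraNneq H => <-.
(* Deleting [x0] keeps [x1] connected to the cycle, so the ear ends at some [y0] other than [x0]. *)
have [|p' [pp' lp' x0p']] := con x0 x1 y _ yx0.
  by apply: contraNneq x1c => ->.
have [||q' [y0 [q1' y0c q2' q3']]] := @first_hit _ (@adj G) (mem c) x1 p' _ _ pp'.
- exact: x1c.
- by rewrite /= lp' cs inE ys orbT.
have y0s : y0 \in s.
  move: y0c; rewrite /= cs inE => /orP[/eqP E|//]; case/negP: x0p'.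
  by apply: q3'; rewrite -E mem_rcons mem_head.
move: q1'; rewrite rcons_path => /andP[pq'].
case/shortenP: pq' => q'' pq'' Uq'' sub lq''.
apply: (@longest_cycle_no_ear G (size c) claws nets omax x0 y0 s (x1 :: q'')) => //.
- move=> z zq; rewrite -cs; have /allP := q2'; apply.
  move: zq; rewrite !inE => /orP[->//|/sub ->]; exact: orbT.
- by rewrite /= x01 rcons_path pq''.
Qed.
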